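(* Let $(W,S)$ be a Coxeter system with $S$ finite. Each cone type $T\in\mathbb{T}$ is expressible as an intersection of cone types of tight gates: for every $T\in\mathbb{T}$ there is a subset $A\subseteq\Gamma^0$ such that $T=\bigcap_{z\in A}T(z^{-1})$ (the empty intersection being $W$).
   Context: $(W,S)$ is a Coxeter system with $S$ finite and $\ell$ is the word length with respect to $S$. $V$ is the real vector space with basis $\{\alpha_s\mid s\in S\}$ and symmetric bilinear form $\langle\alpha_s,\alpha_t\rangle=-\cos(\pi/m(s,t))$ (equal to $-1$ if $m(s,t)=\infty$); $W$ acts on $V$ by $sv=v-2\langle v,\alpha_s\rangle\alpha_s$. Right weak order: $x\preceq y$ iff $\ell(y)=\ell(x)+\ell(x^{-1}y)$. Right descent set: $D_R(w)=\{s\in S\mid\ell(ws)=\ell(w)-1\}$; right-descent roots: $\Phi^R(w)=\{-w\alpha_s\mid s\in D_R(w)\}$. Cone type of $w$: $T(w)=\{v\in W\mid\ell(wv)=\ell(w)+\ell(v)\}$; $\mathbb{T}=\{T(w)\mid w\in W\}$. For $T\in\mathbb{T}$ the cone type part is $Q(T)=\{x\in W\mid T(x^{-1})=T\}$. It is known that each $Q(T)$ has a unique element $g_T\in Q(T)$ with $g_T\preceq x$ for all $x\in Q(T)$ (its gate); $\Gamma=\{g_T\mid T\in\mathbb{T}\}$ is the set of gates and $\Gamma^0=\{g\in\Gamma\mid|\Phi^R(g)|=1\}$ is the set of tight gates. The cone type associated with a gate $z$ is $T(z^{-1})$. *)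

(* Defs.v *)
From mathcomp Require Import all_boot all_order all_algebra.
From mathcomp Require Import all_classical all_reals all_analysis.

Set Implicit Arguments.
Unset Strict Implicit.
Unset Printing Implicit Defensive.

Import Order.TTheory GRing.Theory Num.Theory.
Local Open Scope classical_set_scope.
Local Open Scope group_scope.

(* A Coxeter system (W, S): [S] is seen as a subset of [W] through the injection
   [gen], and [cox_m s t = None] stands for m(s,t) = oo.  The last two fields say
   that W is the group presented by the generators S and the relations
   (st)^m(s,t) = 1 for m(s,t) < oo: S generates W as a group, and every map from
   S to a group which respects the relations extends to W.  Since
   m(s,s) = 1 the generators are involutions, so generation is stated with
   positive words. *)
Record coxeterSystem (W : groupType) (S : finType) := CoxeterSystem {
  gen : S -> W;
  cox_m : S -> S -> option nat;
  gen_inj : injective gen;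
  cox_m_diag : forall s, cox_m s s = Some 1%N;
  cox_m_sym : forall s t, cox_m s t = cox_m t s;
  cox_m_ge2 : forall s t k, s != t -> cox_m s t = Some k -> (1 < k)%N;
  gen_rel : forall s t k, cox_m s t = Some k -> (gen s * gen t) ^+ k = 1;
  gen_generate : forall w, exists u : seq S, \prod_(s <- u) gen s == w;
  gen_universal : forall (G : groupType) (f : S -> G),
    (forall s t k, cox_m s t = Some k -> (f s * f t) ^+ k = 1) ->
    exists phi : {multiplicative W -> G}, forall s, phi (gen s) = f s
}.

Section CoxeterGroup.
Variables (W : groupType) (S : finType) (C : coxeterSystem W S).
Implicit Types (w x y z g : W) (s t : S).

Definition is_length w (n : nat) : bool :=
  [exists u : n.-tuple S, \prod_(s <- u) gen C s == w].

Lemma ex_length w : exists n, is_length w n.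
Proof.
have [u uw] := gen_generate C w.
by exists (size u); apply/existsP; exists (in_tuple u).
Qed.

(* The word length with respect to S. *)
Definition ell w : nat := ex_minn (ex_length w).

Definition weak_le x y : Prop := ell y = (ell x + ell (x^-1 * y)%g)%N.

Definition right_descents w : set S :=
  [set s | (ell (w * gen C s)%g).+1 = ell w].

Definition cone_type w : set W :=
  [set v | ell (w * v)%g = (ell w + ell v)%N].

Definition cone_types : set (set W) := range cone_type.

Definition cone_part (T : set W) : set W := [set x | cone_type x^-1 = T].

Definition is_gate_of (T : set W) g : Prop :=
  cone_part T g /\ forall x, cone_part T x -> weak_le g x.

Definition gates : set W := [set g | exists2 T, cone_types T & is_gate_of T g].

Section Roots.
Variable R : realType.
Local Open Scope ring_scope.

Local Notation geomV := {ffun S -> R^o}.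

Definition simple_root s : geomV := [ffun t => (t == s)%:R].

Definition gram s t : R :=
  if cox_m C s t is Some k then - cos (pi / k%:R) else - 1.

Definition bform (u v : geomV) : R := \sum_s \sum_t u s * v t * gram s t.

Definition simple_refl s (v : geomV) : geomV :=
  v - (2 * bform v (simple_root s)) *: simple_root s.

(* The action of [w] on V is computed along an arbitrarily chosen word for [w];
   the simple reflections satisfy the Coxeter relations, so the choice is
   immaterial. *)
Definition geom_act w (v : geomV) : geomV :=
  foldr simple_refl v (xchoose (gen_generate C w)).

Definition right_descent_roots w : set geomV :=
  [set - geom_act w (simple_root s) | s in right_descents w].

Definition tight_gates : set W :=
  [set g | gates g /\ (right_descent_roots g #= `I_1)%card].

End Roots.
End CoxeterGroup.

(* Main.v *)
(* Let v be outside T(x^-1). Some prefix p s of v satisfies l(p s) = l(p) + 1,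
   p \in T(x^-1) and p s \notin T(x^-1). For u = p^-1 x these two membership
   conditions on x say that p^-1 <= u and s <= u in the right weak order; since
   pairs bounded above have joins, they hold at a least x, namely
   z = p (p^-1 \/ s). Both conditions depend on T(x^-1) only, so z is the gate of
   its cone type; T(x^-1) is included in T(z^-1), which misses v. If r is a right
   descent of z, minimality of z makes z r violate the conditions, which forces
   r = s ^ (p^-1 z): z has a single descent, hence is tight. *)
From HB Require Import structures.
Require Import Defs.
From mathcomp Require Import all_boot all_order all_algebra.
From mathcomp Require Import all_classical all_reals all_analysis.
From mathcomp Require Import zify.

Set Implicit Arguments.
Unset Strict Implicit.
Unset Printing Implicit Defensive.

Local Open Scope classical_set_scope.

(** * The group of reflection cocycles *)

Section ReflectionCocycle.
Local Open Scope group_scope.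

(* (w, N) carries a candidate N for the set of reflections r with l(r w) < l(w);
   the product is the cocycle rule N(x y) = N(x) + x N(y) x^-1 (symmetric
   difference). *)
Definition wreath (W : groupType) : Type := (W * (W -> bool))%type.

Variable W : groupType.
Implicit Types (g h k : wreath W).

HB.instance Definition _ := Choice.on (wreath W).

Definition wreath_one : wreath W := (1, fun=> false).
Definition wreath_inv g : wreath W := (g.1^-1, fun t => g.2 (t ^ g.1^-1)).
Definition wreath_mul g h : wreath W :=
  (g.1 * h.1, fun t => g.2 t (+) h.2 (t ^ g.1)).

Lemma wreath_mulA : associative wreath_mul.
Proof.
move=> g h k; congr pair; rewrite /= ?mulgA //.
by apply/funext => t /=; rewrite conjgM addbA.
Qed.

Lemma wreath_mul1 : left_id wreath_one wreath_mul.
Proof.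
move=> [w N]; congr pair; rewrite /= ?mul1g //.
by apply/funext => t /=; rewrite conjg1.
Qed.

Lemma wreath_mulr1 : right_id wreath_one wreath_mul.
Proof.
move=> [w N]; congr pair; rewrite /= ?mulg1 //.
by apply/funext => t /=; rewrite addbF.
Qed.

Lemma wreath_mulV : left_inverse wreath_one wreath_inv wreath_mul.
Proof.
move=> g; congr pair; rewrite /= ?mulVg //.
by apply/funext => t /=; rewrite addbb.
Qed.

Lemma wreath_mulrV : right_inverse wreath_one wreath_inv wreath_mul.
Proof.
move=> g; congr pair; rewrite /= ?mulgV //.
by apply/funext => t /=; rewrite conjgK addbb.
Qed.

HB.instance Definition _ := isGroup.Build (wreath W)
  wreath_mulA wreath_mul1 wreath_mulr1 wreath_mulV wreath_mulrV.

Lemma expg_wreath1 g n : (g ^+ n).1 = g.1 ^+ n.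
Proof. by elim: n => // n IHn; rewrite !expgS -IHn. Qed.

(** With [c = a b], one factor toggles [a] and [c a]. Since [a] inverts [c], conjugating these by
    [c^n] gives [c^(2n) a] and [c^(2n+1) a], the two new terms of the sum. *)
Lemma expg_wreath_dihedral (a b : W) n x : a * a = 1 -> b * b = 1 ->
  ((wreath_mul (a, eq_op^~ a) (b, eq_op^~ b)) ^+ n).2 x =
  \big[addb/false]_(0 <= j < n.*2) (x == (a * b) ^+ j * a).
Proof.
move=> aa bb; set g : wreath W := wreath_mul _ _; set c := a * b.
have aV := mulg1_eq aa.
have bV := mulg1_eq bb.
have cV : c^-1 = c ^ a by rewrite conjgE /c -mulgA mulKg invgM aV bV.
have swap j : a * c ^- j = c ^+ j * a.
  by rewrite [RHS]conjgC conjXg -cV expVgn.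
have g2 y : g.2 y = (y == a) (+) (y == c * a).
  rewrite /g /=; congr addb; rewrite (can2_eq (conjgK _) (conjgKV _)).
  by rewrite conjgE invgK aV mulgA.
have conj_eq j y z : c ^+ j * y = z * c ^+ j -> (x ^ (c ^+ j) == y) = (x == z).
  move=> yz; rewrite (can2_eq (conjgK _) (conjgKV _)) conjgE invgK mulgA yz.
  by rewrite mulgK.
have g1 : g.1 = c by [].
clearbody g c; elim: n => [|n IHn]; first by rewrite big_geq.
rewrite doubleS !big_nat_recr //= -IHn expgSr -addbA /= expg_wreath1 g1.
congr addb; rewrite g2 -addnn; congr addb; apply: conj_eq.
  by rewrite expgnDr -!mulgA [c ^+ n * (a * _)]mulgA -swap mulgVK.
by rewrite -addnS expgnDr expgS -!mulgA [c ^+ n * (a * _)]mulgA -swap mulgVK.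
Qed.

End ReflectionCocycle.

(** * Inversions and word length *)

Section WeakOrder.
Variables (W : groupType) (S : finType) (C : coxeterSystem W S).
Implicit Types (w x y z u v : W) (s t : S).
Local Open Scope group_scope.
Local Notation gen := (gen C).
Local Notation ell := (ell C).
Local Notation le := (weak_le C).

Lemma gen_invol s : gen s * gen s = 1.
Proof. exact: (gen_rel (cox_m_diag C s)). Qed.

Lemma genV s : (gen s)^-1 = gen s.
Proof. exact: mulg1_eq (gen_invol s). Qed.

Lemma genK s w : gen s * (gen s * w) = w.
Proof. by rewrite mulgA gen_invol mul1g. Qed.

Lemma mulg_genK s w : w * gen s * gen s = w.
Proof. by rewrite -mulgA gen_invol mulg1. Qed.

Lemma gen_ind (P : W -> Prop) :
  P 1 -> (forall s w, P w -> P (gen s * w)) -> forall w, P w.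
Proof.
move=> P1 Ps w; have [u /eqP <-] := gen_generate C w.
by elim: u => [|s u IHu]; rewrite ?big_nil // big_cons; exact: Ps.
Qed.

(** The universal property extends [s |-> (s, {s})] to a morphism into [wreath W]. Its first
    component is the identity, so its second component is a cocycle on [W]. *)
Lemma ex_inversion : exists N : W -> W -> bool,
  (forall s x, N (gen s) x = (x == gen s)) /\
  (forall x y r, N (x * y) r = N x r (+) N y (r ^ x)).
Proof.
have [s t k mst|phi phi_gen] :=
    @gen_universal _ _ C (wreath W) (fun s => (gen s, eq_op^~ (gen s))).
  apply/eqP; rewrite /eq_op /=; apply/andP; split.
    by rewrite expg_wreath1 /= (gen_rel mst).
  apply/eqP/funext => x; rewrite expg_wreath_dihedral ?gen_invol //.
  (* As (s t)^k = 1, the terms j and j + k of the sum coincide, hence cancel. *)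
  rewrite -addnn (big_cat_nat_idem _ (leq0n k)) ?leq_addr //=.
  rewrite -{2}[k]add0n big_addn addnK.
  rewrite [X in _ (+) X](eq_bigr (fun j => x == (gen s * gen t) ^+ j * gen s)) ?addbb //.
  by move=> j _; rewrite expgnDr (gen_rel mst) mulg1.
have phi1 w : (phi w).1 = w.
  elim/gen_ind: w => [|s w IHw].
    apply: (@mulgI _ (phi 1).1).
    by rewrite mulg1 -[in RHS](mulg1 1) gmulfM.
  by rewrite gmulfM /= phi_gen /= IHw.
exists (fun w => (phi w).2); split => [s x|x y r]; first by rewrite phi_gen.
by rewrite gmulfM /= phi1.
Qed.

Definition inversion : W -> W -> bool := projT1 (cid ex_inversion).

Lemma inversion_gen s x : inversion (gen s) x = (x == gen s).
Proof. by rewrite /inversion; case: cid => N []. Qed.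

Lemma inversionM x y r : inversion (x * y) r = inversion x r (+) inversion y (r ^ x).
Proof. by rewrite /inversion; case: cid => N []. Qed.

Lemma inversion1 x : inversion 1 x = false.
Proof.
by have := inversionM 1 1 x; rewrite mulg1 conjg1 addbb.
Qed.

Lemma ell_prod (u : seq S) : (ell (\prod_(s <- u) gen s) <= size u)%N.
Proof.
rewrite /Defs.ell; case: ex_minnP => n _; apply.
by apply/existsP; exists (in_tuple u).
Qed.

Lemma ell_word w : exists2 u : seq S, size u = ell w & \prod_(s <- u) gen s = w.
Proof.
rewrite /Defs.ell; case: ex_minnP => n /existsP[u /eqP uw] _.
by exists u => //; rewrite size_tuple.
Qed.

Lemma ellM x y : (ell (x * y) <= ell x + ell y)%N.
Proof.
have [u <- <-] := ell_word x; have [v <- <-] := ell_word y.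
by rewrite -big_cat /= -size_cat ell_prod.
Qed.

Lemma ellV w : ell w^-1 = ell w.
Proof.
suff le_ellV x : (ell x^-1 <= ell x)%N.
  by apply/eqP; rewrite eqn_leq le_ellV -{1}[w]invgK le_ellV.
have [u <- <-] := ell_word x; rewrite -size_rev; apply: leq_trans (ell_prod _).
by rewrite -{1}[u]revK -prodgV (eq_bigr gen) // => s _; exact: genV.
Qed.

Lemma ell1 : ell 1 = 0%N.
Proof. by apply/eqP; have := ell_prod [::]; rewrite big_nil leqn0. Qed.

Lemma ell_gen s : (ell (gen s) <= 1)%N.
Proof. by have := ell_prod [:: s]; rewrite big_seq1. Qed.

(** Strong exchange: the cocycle rule finds a letter of a reduced word for [w] whose deletion yields
    [r w]. *)
Lemma ell_mul_inversion w r : inversion w r -> (ell (r * w) < ell w)%N.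
Proof.
have [u <- <-] := ell_word w => Nur.
suff [v vu <-] : exists2 v : seq S, (size v < size u)%N &
    \prod_(s <- v) gen s = r * \prod_(s <- u) gen s.
  exact: leq_ltn_trans (ell_prod v) vu.
elim: u r Nur => [|s u IHu] r; first by rewrite big_nil inversion1.
rewrite !big_cons inversionM inversion_gen.
have [->|_] := eqVneq r (gen s); first by exists u; rewrite ?genK.
move=> /IHu[v vu vE]; exists (s :: v) => //.
by rewrite big_cons vE conjgE -!mulgA mulVKg.
Qed.

(** If [s] is not an inversion of [w], it is one of [s w], and strong exchange applied to [s w]
    makes [w] the shorter of the two. *)
Lemma ell_gen_mulN s w : ~~ inversion w (gen s) -> ell (gen s * w) = (ell w).+1.
Proof.
move=> Nsw; have : inversion (gen s * w) (gen s).
  by rewrite inversionM inversion_gen eqxx conjgE mulKg (negPf Nsw).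
move=> /ell_mul_inversion; rewrite genK.
by have := ellM (gen s) w; have := ell_gen s; lia.
Qed.

Lemma ell_gen_mul_inversion s w : inversion w (gen s) -> (ell (gen s * w)).+1 = ell w.
Proof.
move=> /ell_mul_inversion; have := ellM (gen s) (gen s * w); have := ell_gen s.
by rewrite genK; lia.
Qed.

Lemma ell_gen1 s : ell (gen s) = 1%N.
Proof. by rewrite -[gen s]mulg1 ell_gen_mulN ?inversion1 // ell1. Qed.

(** * The right weak order *)

Lemma weak_le_refl x : le x x.
Proof. by rewrite /weak_le mulVg ell1 addn0. Qed.

Lemma weak_le1x x : le 1 x.
Proof. by rewrite /weak_le invg1 mul1g ell1. Qed.

Lemma weak_le_trans y x z : le x y -> le y z -> le x z.
Proof.
rewrite /weak_le => xy yz; apply/eqP; rewrite eqn_leq.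
rewrite -{1}[z](mulVKg x) ellM /= yz xy -addnA leq_add2l.
by rewrite -{1}[z](mulVKg y) mulgA ellM.
Qed.

Lemma weak_le_ell x y : le x y -> (ell x <= ell y)%N.
Proof. by move->; exact: leq_addr. Qed.

Lemma weak_le_gen s x : le (gen s) x <-> inversion x (gen s).
Proof.
rewrite /weak_le ell_gen1 genV; split=> [sx|/ell_gen_mul_inversion <- //].
by apply: contraT => /ell_gen_mulN sx'; move: sx; rewrite sx'; lia.
Qed.

Lemma weak_le_mull a x y : ell (a * x) = (ell a + ell x)%N ->
  ell (a * y) = (ell a + ell y)%N -> le (a * x) (a * y) <-> le x y.
Proof.
rewrite /weak_le invgM -mulgA mulKg => -> ->; rewrite -addnA.
by split=> [/addnI|->].
Qed.

(** Factor [v = x (x^-1 v)]: as [s] is not an inversion of [x], its conjugate [s ^ x] is one of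
    [x^-1 v]. Passing from [x] to [s x] thus shortens the complement by at least the letter
    gained. *)
Lemma weak_le_gen_mul s x v : inversion v (gen s) -> ~~ inversion x (gen s) ->
  le x v -> le (gen s * x) v.
Proof.
move=> sv sx xv; move: sv; rewrite -{1}[v](mulVKg x) inversionM (negPf sx) /=.
move=> /ell_mul_inversion; rewrite conjgE -!mulgA mulVKg => lt.
apply/eqP; rewrite eqn_leq -{1}[v](mulVKg (gen s * x)) ellM /=.
by rewrite ell_gen_mulN // invgM genV -mulgA xv addSn -addnS leq_add2l.
Qed.

Lemma ex_gen_weak_le w : w <> 1 -> exists s, le (gen s) w.
Proof.
have [[|s r] sr wE] := ell_word w; first by rewrite -wE big_nil.
move=> _; exists s; apply/weak_le_gen; apply: contraT => /ell_gen_mulN.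
by rewrite -sr -{1}wE big_cons genK => eP; have := ell_prod r; rewrite eP /=; lia.
Qed.

(** * Joins of bounded pairs *)

Definition is_join x y j :=
  [/\ le x j, le y j & forall v, le x v -> le y v -> le j v].

(* The join is the first alternating product of s and t (letters added on the
   left) that cannot be lengthened; it does not depend on the upper bound v,
   which only ensures that such a product exists. *)
Lemma join_gen s t v : le (gen s) v -> le (gen t) v ->
  exists j, is_join (gen s) (gen t) j.
Proof.
move=> sv tv; pose a i := gen (if odd i then t else s).
pose c := fix c i := if i is i'.+1 then a i' * c i' else 1.
have c_le w k : le (gen s) w -> le (gen t) w ->
    (forall i, (i < k)%N -> ~~ inversion (c i) (a i)) -> le (c k) w /\ ell (c k) = k.
  move=> /weak_le_gen sw /weak_le_gen tw; elim: k => [|k IHk] Nc.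
    by split; [exact: weak_le1x|exact: ell1].
  have [i /ltnW/Nc//|ck ell_ck] := IHk; split => /=; last first.
    by rewrite ell_gen_mulN ?ell_ck ?Nc.
  apply: weak_le_gen_mul => //; last exact: Nc.
  by rewrite /a; case: ifP.
(* Otherwise the alternating product of length [ell v + 1] would lie below [v]. *)
have ex_k : exists k, inversion (c k) (a k).
  apply: contrapT => Nk.
  have [i _|/weak_le_ell + eck] := c_le v (ell v).+1 sv tv.
    by apply/negP => ci; apply: Nk; exists i.
  by rewrite eck ltnn.
have [k ck k_min] := ex_minnP ex_k.
have Nc i : (i < k)%N -> ~~ inversion (c i) (a i).
  by rewrite ltnNge; apply: contra => /k_min.
case: k ck Nc {k_min} => [|k ck Nc]; first by rewrite inversion1.
(* The letter just added is a descent, and so is [a k.+1], which cannot be added; these two letters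
   are [s] and [t] in some order. *)
have ck' : inversion (c k.+1) (a k).
  by rewrite /= inversionM inversion_gen eqxx conjgE mulKg (negPf (Nc k _)).
exists (c k.+1); split; last by move=> w sw tw; have [] := c_le w k.+1 sw tw Nc.
- by apply/weak_le_gen; move: ck ck'; rewrite /a /=; case: odd.
- by apply/weak_le_gen; move: ck ck'; rewrite /a /=; case: odd.
Qed.

Lemma ell_gen_mulK s x : le (gen s) x ->
  ell (gen s * (gen s * x)) = (ell (gen s) + ell (gen s * x))%N.
Proof. by rewrite /weak_le genV genK. Qed.

(* By induction on the length of the upper bound: a common left descent can be
   cancelled; otherwise, for descents s of x and t of y, first join x with
   k = s \/ t (common descent s), then the result with y (common descent t). *)
Lemma ex_join u x y : le x u -> le y u -> exists j, is_join x y j.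
Proof.
have [n] := ubnP (ell u); elim: n u x y => // n IHn u x y.
rewrite ltnS => un.
have shared s x' y' : le (gen s) x' -> le (gen s) y' -> le x' u -> le y' u ->
    exists j, is_join x' y' j.
  move=> sx sy xu yu; have su := weak_le_trans sx xu.
  have le_s x1 y1 : le (gen s) x1 -> le (gen s) y1 ->
      le (gen s * x1) (gen s * y1) <-> le x1 y1.
    move=> sx1 sy1; rewrite -{2}[x1](genK s) -{2}[y1](genK s).
    by apply: iff_sym; apply: weak_le_mull; exact: ell_gen_mulK.
  have [|||j [xj yj j_min]] := IHn (gen s * u) (gen s * x') (gen s * y').
  - by apply: leq_trans un; rewrite -(@ell_gen_mul_inversion s u) //; exact/weak_le_gen.
  - exact/le_s.
  - exact/le_s.
  have ju : le j (gen s * u) by apply: j_min; exact/le_s.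
  (* A descent [s] of [j] would be one of [s u], whereas [s] is already a descent of [u]. *)
  have sj : ~~ inversion j (gen s).
    apply/negP => /weak_le_gen sj.
    have /weak_le_gen/ell_gen_mul_inversion := weak_le_trans sj ju.
    by rewrite genK; move/weak_le_gen: su => /ell_gen_mul_inversion <-; lia.
  have sj' : le (gen s) (gen s * j).
    by apply/weak_le_gen; rewrite inversionM inversion_gen eqxx conjgE mulKg (negPf sj).
  exists (gen s * j); split.
  - by apply/le_s => //; rewrite genK.
  - by apply/le_s => //; rewrite genK.
  - move=> v xv yv; have sv := weak_le_trans sx xv.
    by apply/le_s => //; rewrite genK; apply: j_min; exact/le_s.
move=> xu yu.
have [->|/ex_gen_weak_le[s sx]] := pselect (x = 1).
  by exists y; split=> //; [exact: weak_le1x|exact: weak_le_refl].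
have [->|/ex_gen_weak_le[t ty]] := pselect (y = 1).
  by exists x; split=> //; [exact: weak_le_refl|exact: weak_le1x].
have [k [sk tk k_min]] := join_gen (weak_le_trans sx xu) (weak_le_trans ty yu).
have ku : le k u by apply: k_min; [exact: weak_le_trans sx xu|exact: weak_le_trans ty yu].
have [i [xi ki i_min]] := shared s x k sx sk xu ku.
have iu : le i u by exact: i_min.
have [j [ij yj j_min]] := shared t i y (weak_le_trans tk ki) ty iu yu.
exists j; split=> // [|v xv yv]; first exact: weak_le_trans xi ij.
apply: j_min => //; apply: i_min => //; apply: k_min.
  exact: weak_le_trans sx xv.
exact: weak_le_trans ty yv.
Qed.

(** * Cone types and the edges leaving them *)

Lemma cone_typeE x v :
  cone_type C x^-1 v <-> ell (v^-1 * x) = (ell v + ell x)%N.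
Proof.
by rewrite /cone_type /= ellV -(ellV (x^-1 * v)) invgM invgK addnC.
Qed.

Lemma cone_type1 x : cone_type C x 1.
Proof. by rewrite /cone_type /= mulg1 ell1 addn0. Qed.

(** Triangle inequality for [v^-1 x = (v^-1 y) (y^-1 x)], where [y <= x] lets the length of [y^-1 x]
    cancel. *)
Lemma cone_type_antitone y x v : le y x -> cone_type C x^-1 v -> cone_type C y^-1 v.
Proof.
move=> yx /(cone_typeE _ _).1 xv; apply/(cone_typeE _ _).2; apply/eqP.
rewrite eqn_leq -{1}(ellV v) ellM /= -(leq_add2r (ell (y^-1 * x))) -addnA -yx -xv.
by rewrite -{1}[x](mulVKg y) mulgA ellM.
Qed.

Lemma cone_type_prefix_closed x p v : le p v -> cone_type C x^-1 v -> cone_type C x^-1 p.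
Proof.
move=> pv /(cone_typeE _ _).1 xv; apply/(cone_typeE _ _).2; apply/eqP.
rewrite eqn_leq -{1}(ellV p) ellM /= -(leq_add2r (ell (p^-1 * v))) addnAC -pv -xv.
by rewrite -{1}[v](mulVKg p) invgM -mulgA addnC -(ellV (p^-1 * v)) ellM.
Qed.

(** An edge of the Cayley graph leaving the cone type of [x^-1]. It depends on [x] through this cone
    type alone, so a least such [x] is a gate. *)
Definition crosses x v s := cone_type C x^-1 v /\ ~ cone_type C x^-1 (v * gen s).

(** Put [u = v^-1 x]. Once [ell u = ell v + ell x], membership of [v s] would mean
    [ell (s u) = ell u + 1], which fails exactly when [s] is a descent of [u]. *)
Lemma crossesP x v s : ell (v * gen s) = (ell v).+1 ->
  crosses x v s <-> le v^-1 (v^-1 * x) /\ le (gen s) (v^-1 * x).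
Proof.
move=> vs; rewrite /crosses /weak_le.
have -> : (v^-1)^-1 * (v^-1 * x) = x by rewrite invgK mulVKg.
rewrite ellV.
split=> [[/(cone_typeE _ _).1 xv xvs]|[xv /weak_le_gen/ell_gen_mul_inversion su]].
  split=> //; apply/weak_le_gen; apply: contraT => /ell_gen_mulN su.
  by case: xvs; apply/(cone_typeE _ _).2; rewrite invgM genV -mulgA su xv vs addSn.
split=> [|/(cone_typeE _ _).1]; first exact/(cone_typeE _ _).2.
by rewrite invgM genV -mulgA vs addSn -xv -su => /eqP; rewrite ltn_eqF.
Qed.

(** Strip right descents from [v] until the set [T] is reached; the last letter removed is [s]. *)
Lemma ex_crossing T v : T 1 -> ~ T v ->
  exists p s, [/\ ell (p * gen s) = (ell p).+1, le (p * gen s) v, T p & ~ T (p * gen s)].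
Proof.
move=> T1; have [n] := ubnP (ell v); elim: n v => // n IHn v.
rewrite ltnS => vn Tv.
have [s sv] : exists s, le (gen s) v^-1.
  apply: ex_gen_weak_le => v1; apply: Tv.
  by rewrite -[v]invgK v1 invg1.
move: sv => /weak_le_gen/ell_gen_mul_inversion.
rewrite ellV -[gen s]genV -invgM ellV => sv.
have [Tvs|Tvs] := pselect (T (v * gen s)).
  exists (v * gen s), s; rewrite mulg_genK; split=> //; exact: weak_le_refl.
have [|p [t [pt ptv Tp Tpt]]] := IHn (v * gen s) _ Tvs; first by rewrite sv.
exists p, t; split=> //; apply: weak_le_trans ptv _.
by rewrite /weak_le invgM -mulgA mulVg mulg1 ellV ell_gen1 addn1.
Qed.

(** * Least crossing elements are tight gates *)

Lemma ex_min_crosses x v s : ell (v * gen s) = (ell v).+1 -> crosses x v s ->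
  exists2 z, crosses z v s & forall y, crosses y v s -> le z y.
Proof.
move=> vs /(crossesP _ vs)[vx sx]; have [j [vj sj j_min]] := ex_join vx sx.
exists (v * j); first by apply/crossesP; rewrite ?mulKg.
move=> y /(crossesP _ vs)[vy sy].
(* Both [j] and [v^-1 y] lie above [v^-1], so left multiplication by [v^-1] adds [ell v] to the
   lengths of [v j] and [y] and preserves their order. *)
apply/(@weak_le_mull v^-1).
- by rewrite mulKg ; move: vj; rewrite /weak_le invgK.
- by move: vy; rewrite /weak_le invgK mulVKg.
- by rewrite mulKg; exact: j_min.
Qed.

Lemma min_crosses_tight (R : realType) z v s : ell (v * gen s) = (ell v).+1 ->
  crosses z v s -> (forall y, crosses y v s -> le z y) -> tight_gates C R z.
Proof.
move=> vs zvs z_min; split.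
  exists (cone_type C z^-1); first by exists z^-1.
  split=> // y yz; apply: z_min; rewrite /crosses yz; exact: zvs.
have [zv' zvs'] := zvs; have [vz /weak_le_gen sz] := (crossesP z vs).1 zvs.
(* As [z r <= z], the cone type for [z r] still contains [v]; minimality then denies that [s] is an
   inversion of [v^-1 z r]. It is one of [v^-1 z], so the cocycle rule puts the change on the last
   letter [r]. *)
have desc_conj r : right_descents C z r -> gen r = gen s ^ (v^-1 * z).
  move=> zr; have yz : le (z * gen r) z.
    by rewrite /weak_le invgM -mulgA mulVg mulg1 ellV ell_gen1 addn1.
  have : ~ inversion (v^-1 * (z * gen r)) (gen s).
    move=> sy; have /z_min/weak_le_ell : crosses (z * gen r) v s.
      apply/crossesP => //; split; last exact/weak_le_gen.
      move/(cone_typeE _ _).1 : (cone_type_antitone yz zv').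
      by rewrite /weak_le ellV invgK mulVKg.
    by rewrite -zr ltnn.
  rewrite mulgA => /negP/negPf sy; move: sz.
  rewrite -[v^-1 * z](mulg_genK r) inversionM sy inversion_gen /= => /eqP.
  by rewrite mulg_genK conjgM => /(canRL (conjgK _)) ->; rewrite conjgE mulgV mulg1 invgK.
(* Here [z] is not 1, because the cone type of 1 is all of [W] and contains [v s]. *)
have [r zr] : exists r, right_descents C z r.
  have [|r /weak_le_gen/ell_gen_mul_inversion] := @ex_gen_weak_le z^-1.
    move=> z1; apply: zvs'.
    by rewrite /cone_type /= z1 mul1g ell1 add0n.
  rewrite ellV -[gen r]genV -invgM ellV; by exists r.
suff zE : right_descents C z = [set r].
  by rewrite /right_descent_roots zE image_set1; exact: card_set1.
apply/seteqP; split=> [r' zr'|r' -> //] /=.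
by apply: (@gen_inj _ _ C); rewrite (desc_conj r') // (desc_conj r).
Qed.

End WeakOrder.

(** * Cone types as intersections *)

Theorem corollary4p3 (R : realType) (W : groupType) (S : finType)
    (C : coxeterSystem W S) (T : set W) (hT : cone_types C T) :
  exists2 A : set W, A `<=` tight_gates C R &
    T = \bigcap_(z in A) cone_type C (z^-1)%g.
Proof.
have [w _ <-] := hT; rewrite -[w]invgK; move: (w^-1)%g => x.
(* Taking every tight gate whose cone type contains [T] makes one inclusion immediate. *)
exists [set z | tight_gates C R z /\ cone_type C x^-1 `<=` cone_type C z^-1]%g.
  by move=> z [].
apply/seteqP; split=> [v xv z [_]|v Av]; first exact.
apply: contrapT => xv.
have [p [s [ps psv xp xps]]] := ex_crossing C (cone_type1 C (x^-1)%g) xv.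
have [z zps z_min] := ex_min_crosses ps (conj xp xps).
(* If the cone type of [z^-1] contained [v], it would contain the prefix [p s], which it misses. *)
case: zps.2; apply: (cone_type_prefix_closed psv); apply: Av; split.
  exact: min_crosses_tight zps z_min.
by move=> u; apply: cone_type_antitone; apply: z_min.
Qed.
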